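(* Let $(X,T)$ be a topological dynamical system. Then $(X,T)$ is a weakly mixing $M$-system if and only if $(K(X),T_K)$ is an $M$-system.
   Context: A topological dynamical system (t.d.s.) is a pair $(X,T)$ with $X$ a compact metric space and $T:X\to X$ a continuous surjective map; $\mathbb{Z}_+=\{0,1,2,\dots\}$. $K(X)$ is the space of non-empty closed subsets of $X$ with the Hausdorff metric (a compact metric space), and $T_K:K(X)\to K(X)$ is $T_K(C)=TC$; $(K(X),T_K)$ is again a t.d.s. $(X,T)$ is transitive if for all non-empty open $U,V\subset X$ the set $\{n\in\mathbb{Z}_+: T^{-n}V\cap U\ne\emptyset\}$ is infinite, and weakly mixing if $(X\times X,T\times T)$ is transitive. A t.d.s. is minimal if every orbit $\{x,Tx,T^2x,\dots\}$ is dense. A point $x\in X$ is a minimal point if its orbit closure $\overline{\{x,Tx,T^2x,\dots\}}$ with the restriction of $T$ is a minimal subsystem. An $M$-system is a transitive t.d.s. whose set of minimal points is dense. *)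

(* Defs.v *)
From HB Require Import structures.
From mathcomp Require Import all_boot all_order all_algebra.
From mathcomp Require Import all_classical all_reals interval_inference topology normedtype sequences.

Set Implicit Arguments.
Unset Strict Implicit.
Unset Printing Implicit Defensive.

Import Order.TTheory GRing.Theory Num.Theory.

Local Open Scope classical_set_scope.
Local Open Scope ring_scope.

HB.mixin Record isCompactSpace M & Topological M := {
  compact_space : compact [set: M]
}.

#[short(type="compactMetricType")]
HB.structure Definition CompactMetric (R : numDomainType) :=
  { M of Metric R M & isCompactSpace M }.

Section Metric.
Context {R : realType}.

Lemma near_mdist (X : metricType R) (x : X) (e : R) :
  0 < e -> \forall y \near x, mdist x y < e.
Proof. by move=> e0; have := nbhsx_ballx x e e0; rewrite ballEmdist.
Qed.

Lemma nbhs_mdist (X : metricType R) (x : X) (P : set X) :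
  nbhs x P <-> exists2 e : R, 0 < e & forall y, mdist x y < e -> P y.
Proof.
split; first by move/nbhs_ballP=> [e e0]; rewrite ballEmdist => xP; exists e.
by move=> [e e0 xP]; apply: filterS (near_mdist x e0).
Qed.

Lemma mdist_bounded (X : compactMetricType R) :
  exists2 M : R, 0 < M & forall x y : X, mdist x y < M.
Proof.
have [[x0]|X0] := pselect (exists x0 : X, True); last first.
  by exists 1 => // x; exfalso; apply: X0; exists x.
have /compact_near_coveringP : compact [set: X] := compact_space.
move=> /(_ nat \oo (fun n x => mdist x0 x < n%:R)).
move=> /(_ _ _)[|N _ /(_ _ (leqnn _)) H].
  move=> x _; near=> x' n => /=.
  apply: (@le_lt_trans _ _ (mdist x0 x + 1)).
    apply: le_trans (metric_triangle x0 x x') _.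
    by rewrite lerD2l ltW//; near: x'; exact: near_mdist.
  by near: n; exact: nbhs_infty_gtr.
exists (N%:R + N%:R + 1) => [|x y]; first by rewrite ltr_wpDl// addr_ge0.
apply: le_lt_trans (metric_triangle x x0 y) _.
rewrite (metric_sym x) ltr_pwDr// lerD// ltW//; exact: H.
Unshelve. all: by end_near. Qed.

Lemma unif_continuous_mdist (X : compactMetricType R) (Y : metricType R)
    (f : X -> Y) : continuous f -> forall e : R, 0 < e ->
  exists2 d : R, 0 < d & forall x y, mdist x y < d -> mdist (f x) (f y) < e.
Proof.
move=> cf e e0.
have /compact_near_coveringP : compact [set: X] := compact_space.
move=> /(_ nat \oo (fun n x => forall y, mdist x y < n.+1%:R^-1 ->
  mdist (f x) (f y) < e)).
move=> /(_ _ _)[|N _ /(_ _ (leqnn _)) H]; last first.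
  exists N.+1%:R^-1; first by rewrite invr_gt0 ltr0n.
  by move=> x y; exact: H.
move=> x _.
have e20 : 0 < e / 2 by rewrite divr_gt0.
have /nbhs_mdist[d d0 xd] := cf x _ (near_mdist (f x) e20).
have d20 : 0 < d / 2 by rewrite divr_gt0.
near=> x' n => /= y x'y.
have xx' : mdist x x' < d / 2 by near: x'; exact: near_mdist.
apply: le_lt_trans (metric_triangle (f x') (f x) (f y)) _.
rewrite (metric_sym (f x')) [e]splitr ltrD//; apply: xd.
  by rewrite (lt_trans xx')// ltr_pdivrMr// ltr_pMr// ltr1n.
apply: le_lt_trans (metric_triangle x x' y) _.
rewrite [d]splitr ltrD// (lt_trans x'y)//.
near: n; exact: near_infty_natSinv_lt (PosNum d20).
Unshelve. all: by end_near. Qed.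

End Metric.

(* The max metric, compatible with the library's pseudometric on products. *)
Section ProdMetric.
Context {R : realType}.

Section dist.
Context {X Y : metricType R}.

Definition prod_mdist (p q : X * Y) : R :=
  Num.max (mdist p.1 q.1) (mdist p.2 q.2).

Let prod_mdist_ge0 p q : 0 <= prod_mdist p q.
Proof. by rewrite /prod_mdist le_max mdist_ge0. Qed.

Let prod_mdist_positivity p q : prod_mdist p q = 0 -> p = q.
Proof.
case: p q => [a b] [c d]; rewrite /prod_mdist /= => /eqP.
rewrite eq_le => /andP[]; rewrite ge_max => /andP[ac bd] _.
by congr pair; apply: (@mdist_positivity R); apply/eqP;
  rewrite eq_le mdist_ge0 andbT.
Qed.

Let prod_ballE p e : ball p e = [set q | prod_mdist p q < e].
Proof.
apply/seteqP; split => q /=; rewrite /prod_mdist gt_max.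
  by move=> -[]; rewrite !ballEmdist /= => -> ->.
by move=> /andP[? ?]; split; rewrite ballEmdist.
Qed.

HB.instance Definition _ := @PseudoMetric_isMetric.Build R (X * Y)%type
  prod_mdist prod_mdist_ge0 prod_mdist_positivity prod_ballE.
End dist.

Let prod_compact (X Y : compactMetricType R) : compact [set: X * Y].
Proof. by rewrite -setXTT; apply: compact_setX; exact: compact_space. Qed.

HB.instance Definition _ (X Y : compactMetricType R) :=
  isCompactSpace.Build (X * Y)%type (@prod_compact X Y).
End ProdMetric.

(* The restricted metric, compatible with the library's initial topology on
   set_type A. *)
Section SubMetric.
Context {R : realType} {X : metricType R} (A : set X).

Definition sub_mdist (p q : A) : R := mdist (set_val p) (set_val q).

Let sub_mdist_ge0 p q : 0 <= sub_mdist p q.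
Proof. exact: mdist_ge0. Qed.

Let sub_mdist_positivity p q : sub_mdist p q = 0 -> p = q.
Proof. by move=> /mdist_positivity pq; apply: val_inj; rewrite -!set_valE. Qed.

Let sub_ballE p e : ball p e = [set q | sub_mdist p q < e].
Proof. by rewrite -[LHS]initial_ballE ballEmdist. Qed.

HB.instance Definition _ := @PseudoMetric_isMetric.Build R A
  sub_mdist sub_mdist_ge0 sub_mdist_positivity sub_ballE.
End SubMetric.

Section Hyperspace.
Context {R : realType} {X : compactMetricType R}.

Record hyperspace := Hyperspace {
  hset :> set X;
  hset_closed : closed hset;
  hset_nonempty : hset !=set0
}.

Lemma hyperspace_eq (A B : hyperspace) : hset A = hset B -> A = B.
Proof.
case: A B => [A cA nA] [B cB nB] /= AB; subst B.
by congr Hyperspace; exact: Prop_irrelevance.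
Qed.

HB.instance Definition _ := gen_eqMixin hyperspace.
HB.instance Definition _ := gen_choiceMixin hyperspace.

Definition thickening (A : set X) (e : R) : set X := \bigcup_(a in A) ball a e.

(* The set of radii is nonempty when A and B are, because X is bounded. *)
Definition hausdorff_dist (A B : set X) : R :=
  inf [set e | [/\ 0 < e, A `<=` thickening B e & B `<=` thickening A e]].

Lemma thickeningP (A : set X) (e : R) (x : X) :
  thickening A e x <-> exists2 a, A a & mdist a x < e.
Proof.
by split=> -[a Aa] ax; exists a => //; move: ax; rewrite ballEmdist.
Qed.

Lemma thickening_le (A : set X) (e e' : R) :
  e <= e' -> thickening A e `<=` thickening A e'.
Proof.
by move=> ee' x /thickeningP[a Aa ax]; apply/thickeningP; exists a => //;
  exact: lt_le_trans ee'.
Qed.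

Let E (A B : set X) : set R :=
  [set e | [/\ 0 < e, A `<=` thickening B e & B `<=` thickening A e]].

Let E_lb A B : has_lbound (E A B).
Proof. by exists 0 => e [/ltW]. Qed.

Let E_nonempty (A B : hyperspace) : E A B !=set0.
Proof.
have [M M0 XM] := @mdist_bounded R X.
have [[a Aa] [b Bb]] := (hset_nonempty A, hset_nonempty B).
by exists M; split=> // x _; apply/thickeningP; [exists b|exists a].
Qed.

Let hdist_le A B e : E A B e -> hausdorff_dist A B <= e.
Proof. exact: (ge_inf (E_lb A B)). Qed.

Lemma hausdorff_dist_lt (A B : hyperspace) (e : R) : hausdorff_dist A B < e <->
  exists2 e', e' < e &
    [/\ 0 < e', A `<=` thickening B e' & B `<=` thickening A e'].
Proof.
split=> [AB|].
  by have [e' Ee' e'e] := inf_lt (E_nonempty A B) AB; exists e'.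
by move=> [e' e'e Ee']; apply: le_lt_trans e'e; exact: hdist_le.
Qed.

Let hdist_ge0 (A B : hyperspace) : 0 <= hausdorff_dist A B.
Proof. by apply: (lb_le_inf (E_nonempty A B)) => e [/ltW]. Qed.

Let hdistxx (A : hyperspace) : hausdorff_dist A A = 0.
Proof.
apply/eqP; rewrite eq_le hdist_ge0 andbT; apply/ler_addgt0Pl => e e0.
rewrite addr0; apply: hdist_le => //; split=> // x Ax;
  by apply/thickeningP; exists x; rewrite ?mdistxx.
Qed.

Let hdist_sym (A B : hyperspace) : hausdorff_dist A B = hausdorff_dist B A.
Proof.
by congr inf; apply/seteqP; split=> e [e0 AB BA].
Qed.

Let hdist_sub (A B : hyperspace) : hausdorff_dist A B = 0 -> A `<=` B.
Proof.
move=> AB0 x Ax; apply: (hset_closed (h := B)).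
move=> U /nbhs_mdist[e e0 xU].
have /hausdorff_dist_lt[e' e'e [_ + _]] : hausdorff_dist A B < e by rewrite AB0.
move=> /(_ _ Ax)/thickeningP[b Bb bx]; exists b; split=> //; apply: xU.
by rewrite metric_sym (lt_trans bx).
Qed.

Let hdist_positivity (A B : hyperspace) : hausdorff_dist A B = 0 -> A = B.
Proof.
move=> AB; apply: hyperspace_eq; apply/seteqP; split; apply: hdist_sub => //.
by rewrite hdist_sym.
Qed.

Let hdist_triangle (B A C : hyperspace) :
  hausdorff_dist A C <= hausdorff_dist A B + hausdorff_dist B C.
Proof.
have tr (U V W : set X) e1 e2 : U `<=` thickening V e1 ->
    V `<=` thickening W e2 -> U `<=` thickening W (e1 + e2).
  move=> UV VW x /UV/thickeningP[v /VW/thickeningP[w Ww wv] vx].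
  apply/thickeningP; exists w => //.
  by rewrite (le_lt_trans (metric_triangle w v x))// addrC ltrD.
apply/ler_addgt0Pl => e e0.
have e20 : 0 < e / 2 by rewrite divr_gt0.
have /hausdorff_dist_lt[e1 le1 [e10 AB BA]] :
  hausdorff_dist A B < hausdorff_dist A B + e / 2 by rewrite ltrDl.
have /hausdorff_dist_lt[e2 le2 [e20' BC CB]] :
  hausdorff_dist B C < hausdorff_dist B C + e / 2 by rewrite ltrDl.
apply: (@le_trans _ _ (e1 + e2)).
  apply: hdist_le => //; split; first exact: addr_gt0.
    exact: tr AB BC.
  by rewrite addrC; exact: tr CB BA.
by rewrite [e]splitr addrACA ![e / 2 + _]addrC lerD ?ltW.
Qed.

HB.instance Definition _ := @isMetric.Build R hyperspace
  (fun A B => hausdorff_dist A B) hdistxx hdist_positivity hdist_sym hdist_triangle.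

Lemma hyperspace_mdistE (A B : hyperspace) : mdist A B = hausdorff_dist A B.
Proof. by []. Qed.

Let hyperspace_compact : compact [set: hyperspace].
Proof.
rewrite compact_ultra => F FU _.
pose L := [set x : X | forall e : R, 0 < e ->
  F [set C | exists2 c, hset C c & mdist x c < e]].
have closedL : closed L.
  move=> x Lx e e0.
  have e20 : 0 < e / 2 by rewrite divr_gt0.
  have [y [Ly xy]] := Lx _ (near_mdist x e20).
  apply: filterS (Ly _ e20) => C [c Cc yc]; exists c => //.
  by rewrite (le_lt_trans (metric_triangle x y c))// [e]splitr ltrD.
have notL x : ~ L x -> exists2 e : R, 0 < e &
    F [set C | forall c, hset C c -> e <= mdist x c].
  move=> /existsNP[e /not_implyP[e0]] nF; exists e => //.
  have [//|] := in_ultra_setVsetC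
    [set C | exists2 c, hset C c & mdist x c < e] FU.
  apply: filterS => C nC c Cc; rewrite leNgt; apply/negP => xc.
  by apply: nC; exists c.
have cX : near_covering [set: X].
  exact/compact_near_coveringP/compact_space.
have FF : ProperFilter F by exact: ultra_proper.
have up (e : R) : 0 < e -> F [set C | hset C `<=` thickening L e].
  move=> e0; suff /(cX _ F) : forall x, [set: X] x ->
      \forall x' \near x & C \near F, hset C x' -> thickening L e x'.
    by apply: filterS => C H c; exact: H.
  move=> x _.
  have [Lx|/notL[r r0 Fr]] := pselect (L x).
    exists ([set x' | mdist x x' < e], setT).
      by split; [exact: near_mdist|exact: filterT].
    by move=> [x' C] [/= xx' _] _; apply/thickeningP; exists x.
  exists ([set x' | mdist x x' < r],
    [set C | forall c, hset C c -> r <= mdist x c]).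
    by split => //; exact: near_mdist.
  by move=> [x' C] [/= xx' rC] /rC; rewrite leNgt xx'.
have low (e : R) : 0 < e -> F [set C | L `<=` thickening (hset C) e].
  move=> e0; have e20 : 0 < e / 2 by rewrite divr_gt0.
  suff /(cX _ F) : forall x, [set: X] x ->
      \forall x' \near x & C \near F, L x' -> thickening (hset C) e x'.
    by apply: filterS => C H c; exact: H.
  move=> x _.
  have [Lx|nLx] := pselect (L x); last first.
    have : nbhs x (~` L) by apply: open_nbhs_nbhs; split=> //; exact: closed_openC.
    move=> nx; exists (~` L, setT); first by split=> //=; exact: filterT.
    by move=> [x' C] [].
  exists ([set x' | mdist x x' < e / 2],
    [set C | exists2 c, hset C c & mdist x c < e / 2]).
    by split => //=; [exact: near_mdist|exact: Lx].
  move=> [x' C] [/= xx' [c Cc xc]] _; apply/thickeningP; exists c => //.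
  rewrite (le_lt_trans (metric_triangle c x x'))// [e]splitr ltrD//.
  by rewrite metric_sym.
have Lne : L !=set0.
  have /filter_ex[C] := up 1 ltr01.
  by have [c Cc] := hset_nonempty C => /(_ _ Cc)/thickeningP[x]; exists x.
exists (Hyperspace closedL Lne); split=> //= U.
move=> /nbhs_mdist[e e0 LU].
have e20 : 0 < e / 2 by rewrite divr_gt0.
apply: filterS (filterI (up _ e20) (low _ e20)) => C [CL LC].
apply: LU; rewrite hyperspace_mdistE; apply/hausdorff_dist_lt.
by exists (e / 2) => //; rewrite ltr_pdivrMr// ltr_pMr// ltr1n.
Qed.

HB.instance Definition _ := isCompactSpace.Build hyperspace hyperspace_compact.

End Hyperspace.
Arguments hyperspace {R} X.

Record tds (R : realType) := TDS {
  tds_space :> compactMetricType R;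
  tds_map : tds_space -> tds_space;
  tds_map_continuous : continuous tds_map;
  tds_map_surjective : forall y, exists x, tds_map x = y
}.
Arguments tds_map {R t}.

Section Product.
Context {R : realType} (S1 S2 : tds R).

Definition prod_map (p : S1 * S2) : S1 * S2 := (tds_map p.1, tds_map p.2).

Let prod_map_continuous : continuous prod_map.
Proof.
move=> p; apply: cvg_pair => /=.
  by apply: continuous_comp; [exact: cvg_fst|exact: tds_map_continuous].
by apply: continuous_comp; [exact: cvg_snd|exact: tds_map_continuous].
Qed.

Let prod_map_surjective q : exists p, prod_map p = q.
Proof.
case: q => q1 q2; have [p1 <-] := tds_map_surjective q1.
by have [p2 <-] := tds_map_surjective q2; exists (p1, p2).
Qed.

Definition prod_tds : tds R := TDS prod_map_continuous prod_map_surjective.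
End Product.

Section Subsystem.
Context {R : realType} (S : tds R) (A : set S).

(* T maps A onto A, so that (A, T|A) is again a t.d.s. *)
Definition is_subsystem := closed A /\ tds_map @` A = A.

Context (subA : is_subsystem).

Lemma sub_map_subproof (x : A) : tds_map (set_val x) \in A.
Proof.
by rewrite inE -[X in X _](proj2 subA); exists (set_val x) => //; exact: set_valP.
Qed.

Definition sub_map (x : A) : A :=
  exist _ (tds_map (set_val x)) (sub_map_subproof x).

Let sub_compact : compact [set: A].
Proof.
have cA : compact A.
  exact: (subclosed_compact (proj1 subA) (@compact_space R S) (@subsetT _ A)).
move=> F FF _.
have FA : (set_val @ F) A.
  by apply: (@filterS _ F _ setT) => [x _|]; [exact: set_valP|exact: filterT].
have [p [Ap clp]] := cA _ _ FA.
exists (exist _ p (mem_set Ap)); split=> // U V FU /nbhs_mdist[e e0 pV].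
have FU' : F (set_val @^-1` (set_val @` U)).
  by apply: filterS FU => x Ux; exists x.
have [_ [[x Ux <-] px]] := clp _ _ FU' (near_mdist p e0).
by exists x; split => //; exact: pV.
Qed.

Let sub_map_continuous : continuous sub_map.
Proof.
move=> x; move=> U /nbhs_mdist[e e0 xU].
have /nbhs_mdist[d d0 xd] :=
  @tds_map_continuous _ S (set_val x) _ (near_mdist (tds_map (set_val x)) e0).
by apply/nbhs_mdist; exists d => // y xy; apply: xU; exact: xd.
Qed.

Let sub_map_surjective y : exists x, sub_map x = y.
Proof.
have : A (set_val y) by exact: set_valP.
rewrite -[X in X _](proj2 subA) => -[x Ax xy].
by exists (exist _ x (mem_set Ax)); apply: val_inj.
Qed.

Definition subsystem_space : compactMetricType R :=
  HB.pack_for (compactMetricType R) (set_type A)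
    (Metric.on (set_type A)) (isCompactSpace.Build (set_type A) sub_compact).

Definition subsystem : tds R :=
  @TDS R subsystem_space sub_map sub_map_continuous sub_map_surjective.
End Subsystem.

Section HyperSystem.
Context {R : realType} (S : tds R).

Lemma hyper_map_closed (C : hyperspace S) : closed (tds_map @` C).
Proof.
apply: compact_closed; first exact: metric_hausdorff.
apply: continuous_compact.
  by apply: continuous_subspaceT; exact: tds_map_continuous.
exact: subclosed_compact (hset_closed (h := C)) (@compact_space R S) _.
Qed.

Lemma hyper_map_nonempty (C : hyperspace S) : (tds_map @` C) !=set0.
Proof. by have [c Cc] := hset_nonempty C; exists (tds_map c), c. Qed.

Definition hyper_map (C : hyperspace S) : hyperspace S :=
  Hyperspace (@hyper_map_closed C) (hyper_map_nonempty C).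

Let hyper_map_continuous : continuous hyper_map.
Proof.
move=> C U /nbhs_mdist[e e0 CU].
have e20 : 0 < e / 2 by rewrite divr_gt0.
have [d d0 dP] := unif_continuous_mdist (@tds_map_continuous _ S) e20.
have thick (A B : set S) r : r < d -> A `<=` thickening B r ->
    tds_map @` A `<=` thickening (tds_map @` B) (e / 2).
  move=> rd AB _ [x /AB/thickeningP[b Bb bx] <-]; apply/thickeningP.
  by exists (tds_map b); [exists b|apply: dP; exact: lt_trans rd].
apply/nbhs_mdist; exists d => // D /hausdorff_dist_lt[r rd [r0 CD DC]].
apply: CU; apply/hausdorff_dist_lt; exists (e / 2).
  by rewrite ltr_pdivrMr// ltr_pMr// ltr1n.
by split=> //=; exact: thick rd _.
Qed.

Let hyper_map_surjective D : exists C, hyper_map C = D.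
Proof.
have cC : closed (tds_map @^-1` D).
  apply: preimage_closed (hset_closed (h := D)) => x _.
  exact: tds_map_continuous.
have nC : (tds_map @^-1` D) !=set0.
  have [y Dy] := hset_nonempty D; have [x xy] := tds_map_surjective y.
  by exists x; rewrite /= xy.
exists (Hyperspace cC nC); apply: hyperspace_eq; apply/seteqP; split=> /= y.
  by move=> [x Dx <-].
by have [x <-] := tds_map_surjective y => Dx; exists x.
Qed.

Definition hyper_tds : tds R := TDS hyper_map_continuous hyper_map_surjective.
End HyperSystem.

Section Dynamics.
Context {R : realType}.
Implicit Types S : tds R.

Definition orbit S (x : S) : set S :=
  [set iter n tds_map x | n in [set: nat]].

Definition transitive_tds S := forall U V : set S,
  open U -> open V -> U !=set0 -> V !=set0 ->
  infinite_set [set n | iter n tds_map @^-1` V `&` U !=set0].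

Definition weakly_mixing S := transitive_tds (prod_tds S S).

Definition minimal_tds S := forall x : S, dense (orbit x).

Definition minimal_point S (x : S) :=
  exists subA : is_subsystem (closure (orbit x)), minimal_tds (subsystem subA).

Definition M_system S := transitive_tds S /\ dense [set x : S | minimal_point x].

End Dynamics.

(* Main.v *)
(* Minimal points are the uniformly recurrent ones: their return times to each
   of their neighbourhoods are syndetic.  Every closed forward invariant set
   contains such a point, and equivariant continuous maps preserve them.

   If X is a weakly mixing M-system, Furstenberg's intersection lemma makes
   finitely many transfers U_i -> V_i happen at the same time, which is
   transitivity of K(X) on finite sets, and finite sets are dense.  For minimal
   points: if p and q are minimal, some (a, b) in the product of their orbit
   closures is minimal, and so is each (T^i a, T^j b); hence minimal points are
   dense in products.  As (C, D) |-> C u D is equivariant, the closed sets which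
   are limits of minimal points of K(X) are stable under unions; singletons are
   among them, hence so are finite sets.

   Conversely, moving a singleton of K(X) close to {y1, y2} gives weak mixing,
   and minimal points of K(X) near {x} produce minimal points of X near x. *)

From mathcomp Require Import all_boot all_order all_algebra lra.
From mathcomp Require Import all_classical topology sequences.
Require Import Defs.
From mathcomp Require Import all_reals.

Set Implicit Arguments.
Unset Strict Implicit.
Unset Printing Implicit Defensive.

Import Order.TTheory GRing.Theory Num.Theory.

Local Open Scope classical_set_scope.
Local Open Scope ring_scope.

(** * Closure, openness and density in terms of distances; finite nets *)

Section MetricFacts.
Context {R : realType}.

Lemma continuous_mdist (X Y : metricType R) (f : X -> Y) (x : X) (e : R) :
  continuous f -> 0 < e ->
  exists2 d : R, 0 < d & forall y, mdist x y < d -> mdist (f x) (f y) < e.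
Proof.
by move=> cf e0; have /nbhs_mdist := cf x _ (near_mdist (f x) e0).
Qed.

Lemma closure_mdist (X : metricType R) (A : set X) (x : X) :
  closure A x <-> forall e : R, 0 < e -> exists2 a, A a & mdist x a < e.
Proof.
split=> [Ax e e0|H U /nbhs_mdist[e e0 xU]].
  by have [a [Aa xa]] := Ax _ (near_mdist x e0); exists a.
by have [a Aa xa] := H _ e0; exists a; split=> //; exact: xU.
Qed.

Lemma open_mdist (X : metricType R) (U : set X) (x : X) :
  open U -> U x -> exists2 e : R, 0 < e & forall y, mdist x y < e -> U y.
Proof. by move=> oU Ux; apply/nbhs_mdist; exact: open_nbhs_nbhs. Qed.

Lemma interior_mdist (X : metricType R) (x : X) (e : R) :
  0 < e -> [set y | mdist x y < e]° x.
Proof. exact: near_mdist. Qed.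

Lemma dense_mdist (X : metricType R) (A : set X) :
  dense A <-> forall (x : X) (e : R), 0 < e -> exists2 a, A a & mdist x a < e.
Proof.
split=> [dA x e e0|H U [x Ux] oU].
  have [a [Ua Aa]] := dA _ (ex_intro _ x (interior_mdist x e0)) (@open_interior _ _).
  by exists a => //; exact: (interior_subset Ua).
have [e e0 xU] := open_mdist oU Ux.
by have [a Aa xa] := H x e e0; exists a; split=> //; exact: xU.
Qed.

Lemma finite_net (X : compactMetricType R) (C : set X) (e : R) :
  closed C -> 0 < e ->
  exists2 t : seq X, (forall y, y \in t -> C y) &
    forall c, C c -> exists2 y, y \in t & mdist y c < e.
Proof.
move=> cC e0.
have /compact_near_coveringP CC : compact C.
  exact: subclosed_compact cC (@compact_space R X) _.
(* The lists containing [s], for varying [s], generate a filter. Near [x] every list through [x]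
   works, so compactness yields one list for all of [C]. *)
pose B (s : seq X) := [set t : seq X | {subset s <= t}].
have nB : ProperFilter (filter_from [set: seq X] B).
  apply: filter_from_proper; last by move=> s _; exists s => //= x.
  apply: filter_from_filter; first by exists [::].
  move=> s t _ _; exists (s ++ t) => // u su.
  by split=> x xs; apply: su; rewrite mem_cat xs ?orbT.
have := CC _ _ (fun t c => exists2 y, y \in [seq y <- t | `[< C y >]] & mdist y c < e)
  (@filter_filter _ _ nB).
case=> [x Cx|s _ /(_ s)].
  exists ([set y | mdist x y < e], B [:: x]).
    by split; [exact: near_mdist|exists [:: x]].
  move=> [y t] [/= xy xt]; exists x => //.
  by rewrite mem_filter xt ?inE// andbT; apply/asboolP.
move=> /(_ (fun _ => id)) H; exists [seq y <- s | `[< C y >]] => //.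
by move=> y; rewrite mem_filter => /andP[/asboolP].
Qed.

End MetricFacts.

(** * Iterates of the map *)

Section Recurrence.
Context {R : realType}.
Implicit Types S : tds R.

Lemma iter_continuous S n : continuous (iter n (@tds_map R S)).
Proof.
elim: n => [|n IHn] x; first exact: cvg_id.
by apply: (@continuous_comp _ _ _ (iter n tds_map) tds_map) => //;
  [exact: IHn|exact: tds_map_continuous].
Qed.

Lemma iter_surjective S n (y : S) : exists x, iter n tds_map x = y.
Proof.
elim: n y => [|n IHn] y; first by exists y.
by have [z <-] := tds_map_surjective y; have [x <-] := IHn z; exists x.
Qed.

(** Lets a nearby point shadow an orbit for [L] steps, the span within which a uniformly recurrent
    point returns. *)
Lemma iter_continuous_upto S (L : nat) (x : S) (e : R) : 0 < e ->
  exists2 d : R, 0 < d & forall i y, (i <= L)%N -> mdist x y < d ->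
    mdist (iter i tds_map x) (iter i tds_map y) < e.
Proof.
move=> e0; elim: L => [|L [d d0 IH]].
  by exists e => // i y; rewrite leqn0 => /eqP ->.
have [d' d'0 H] := continuous_mdist x (@iter_continuous S L.+1) e0.
exists (Num.min d d'); first by rewrite lt_min d0.
move=> i y; rewrite leq_eqVlt lt_min => /orP[/eqP ->|iL] /andP[xd xd'].
  exact: H.
exact: IH.
Qed.

(** * Invariant sets, uniform recurrence and minimal points *)

Definition forward_invariant S (A : set S) := forall x, A x -> A (tds_map x).

Lemma forward_invariant_iter S (A : set S) n x :
  forward_invariant A -> A x -> A (iter n tds_map x).
Proof. by move=> iA Ax; elim: n => //= n; exact: iA. Qed.

Lemma forward_invariant_closure_orbit S (x : S) :
  forward_invariant (closure (orbit x)).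
Proof.
move=> y /closure_mdist Hy; apply/closure_mdist => e e0.
have [d d0 H] := continuous_mdist y (@tds_map_continuous R S) e0.
have [_ [n _ <-] yn] := Hy _ d0.
by exists (tds_map (iter n tds_map x)); [exists n.+1|exact: H].
Qed.

Lemma closure_orbit_refl S (x : S) : closure (orbit x) x.
Proof. by apply: subset_closure; exists 0%N. Qed.
Arguments closure_orbit_refl {S} x.

Lemma closure_orbit_sub S (A : set S) x :
  closed A -> forward_invariant A -> A x -> closure (orbit x) `<=` A.
Proof.
move=> cA iA Ax; rewrite [X in _ `<=` X](iffLR (closure_id A) cA).
by apply: closureS => _ [n _ <-]; exact: forward_invariant_iter.
Qed.

Definition uniformly_recurrent S (x : S) := forall e : R, 0 < e ->
  exists L, forall n, exists2 i, (i <= L)%N &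
    mdist x (iter i tds_map (iter n tds_map x)) < e.

(** Each orbit in [B] enters the ball around [x], at a time that also works for nearby starting
    points. Compactness of [B] bounds these times, in particular along the orbit of [x]. *)
Lemma uniformly_recurrent_minimal S (B : set S) x :
  closed B -> forward_invariant B -> B x ->
  (forall y, B y -> closure (orbit y) x) -> uniformly_recurrent x.
Proof.
move=> cB iB Bx minB e e0.
have /compact_near_coveringP CB : compact B.
  exact: subclosed_compact cB (@compact_space R S) _.
have [|N _ HN] := CB _ \oo
    (fun N y => exists2 i, (i <= N)%N & mdist x (iter i tds_map y) < e) _.
  move=> y /minB/closure_mdist/(_ _ e0)[_ [i _ <-] xi].
  have [d d0 H] : exists2 d : R, 0 < d & forall z, mdist y z < d ->
      mdist x (iter i tds_map z) < e.
    have e'0 : 0 < e - mdist x (iter i tds_map y) by rewrite subr_gt0.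
    have [d d0 H] := continuous_mdist y (@iter_continuous S i) e'0.
    exists d => // z /H yz.
    apply: le_lt_trans (metric_triangle x (iter i tds_map y) _) _; lra.
  exists ([set z | mdist y z < d], [set n | (i <= n)%N]).
    by split; [exact: near_mdist|exists i].
  by move=> [z n] [/= yz iN]; exists i => //; exact: H.
exists N => n; apply: (HN N (leqnn N)); exact: forward_invariant_iter.
Qed.

(** Some T^n x close to [y] returns near [x] within [L] steps, and [y] shadows it for that long;
    hence [d] is chosen after [L]. *)
Lemma uniformly_recurrent_closure_orbit S (x y : S) :
  uniformly_recurrent x -> closure (orbit x) y -> closure (orbit y) x.
Proof.
move=> Hx /closure_mdist xy; apply/closure_mdist => e e0.
have e20 : 0 < e / 2 by rewrite divr_gt0.
have [L HL] := Hx _ e20.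
have [d d0 Hd] := iter_continuous_upto L y e20.
have [_ [n _ <-] yn] := xy _ d0.
have [i iL xi] := HL n.
exists (iter i tds_map y); first by exists i.
apply: le_lt_trans (metric_triangle x (iter i tds_map (iter n tds_map x)) _) _.
by rewrite [e]splitr ltrD// metric_sym; exact: Hd.
Qed.

Lemma iter_sub_map S (A : set S) (subA : is_subsystem A) n (y : A) :
  set_val (iter n (sub_map subA) y) = iter n tds_map (set_val y).
Proof. by elim: n => //= n <-. Qed.

Lemma minimal_pointP S (x : S) : minimal_point x <-> uniformly_recurrent x.
Proof.
split=> [[subA minA]|Hx].
  apply: (uniformly_recurrent_minimal (proj1 subA)).
  - exact: forward_invariant_closure_orbit.
  - exact: closure_orbit_refl.
  move=> y Ay; apply/closure_mdist => e e0.
  have /dense_mdist Dy := minA (exist _ y (mem_set Ay)).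
  have [_ [n _ <-] xn] := Dy (exist _ x (mem_set (closure_orbit_refl x))) _ e0.
  exists (iter n tds_map y); first by exists n.
  by have := iter_sub_map subA n (exist _ y (mem_set Ay)) => <-.
have subA : is_subsystem (closure (orbit x)).
  split; first exact: closed_closure.
  apply/seteqP; split=> [_ [y + <-]|]; first exact: forward_invariant_closure_orbit.
  (* The orbit closure is viewed as a point of K(X), whose image is known to be closed. *)
  pose C := Hyperspace (@closed_closure _ (orbit x))
    (ex_intro _ x (closure_orbit_refl x)).
  have cT : closed (tds_map @` closure (orbit x)) by exact: (@hyper_map_closed R S C).
  apply: closure_orbit_sub => //.
    move=> _ [y Ay <-]; exists (tds_map y) => //.
    exact: forward_invariant_closure_orbit.
  (* It remains to find [x] in T(A), where A is its orbit closure: [x] lies in the orbit closure of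
     T x, which the closed invariant set T(A) contains. *)
  have ATx : closure (orbit x) (tds_map x).
    exact/forward_invariant_closure_orbit/closure_orbit_refl.
  have := uniformly_recurrent_closure_orbit Hx ATx.
  apply: (closure_orbit_sub cT).
    move=> _ [y Ay <-]; exists (tds_map y) => //.
    exact: forward_invariant_closure_orbit.
  by exists x => //; exact: closure_orbit_refl.
exists subA => y; apply/dense_mdist => z e e0.
have Ay : closure (orbit x) (set_val y) by exact: set_valP.
have Az : closure (orbit x) (set_val z) by exact: set_valP.
have /closure_mdist/(_ _ e0)[_ [n _ <-] zn] : closure (orbit (set_val y)) (set_val z).
  apply: closure_orbit_sub Az; first exact: closed_closure.
    exact: forward_invariant_closure_orbit.
  exact: uniformly_recurrent_closure_orbit.
exists (iter n (sub_map subA) y); first by exists n.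
by rewrite -iter_sub_map in zn.
Qed.

(* Zorn's lemma applied to the complements of closed invariant sets. *)
Lemma exists_uniformly_recurrent S (A : set S) :
  closed A -> forward_invariant A -> A !=set0 ->
  exists2 x, A x & uniformly_recurrent x.
Proof.
move=> cA iA [a Aa].
(* The second condition makes the complement of [U] forward invariant, the third makes it meet
   [A]. *)
pose P := [set U : set S | [/\ open U, forall x, U (tds_map x) -> U x &
  ~ A `<=` U]].
have [F FP totF|U [[oU iU AU] maxU]] := @Zorn_bigcup S P.
  split.
  - by apply: bigcup_open => V /FP[].
  - by move=> x [V FV Vx]; exists V => //; have [_ + _] := FP _ FV; exact.
  move=> AF.
  have [U0 FU0 _] := AF _ Aa.
  (* Tails of the chain generate a filter; if the union covered [A], compactness would give a single
     member covering [A]. *)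
  pose B (U : set S) := [set V : set S | F V /\ U `<=` V].
  have nB : ProperFilter (filter_from F B).
    apply: filter_from_proper; last by move=> U FU; exists U; split.
    apply: filter_from_filter; first by exists U0.
    move=> U V FU FV; have [UV|VU] := totF _ _ FU FV; [exists V|exists U] => //.
      by move=> W [FW VW]; split; split=> //; exact: subset_trans VW.
    by move=> W [FW VW]; split; split=> //; exact: subset_trans VW.
  have /compact_near_coveringP CA : compact A.
    exact: subclosed_compact cA (@compact_space R S) _.
  have [|V FV /(_ V)] := CA _ _ (fun V x => V x) (@filter_filter _ _ nB).
    move=> x /AF[V FV Vx]; exists (V, B V) => /=.
      split; last by exists V.
      by apply: open_nbhs_nbhs; split=> //; have [] := FP _ FV.
    by move=> [y W] [/= Vy [_ VW]]; exact: VW.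
  by move=> /(_ (conj FV (fun _ => id))) AV; have [_ _ /(_ AV)] := FP _ FV.
have [x Ax nUx] : exists2 x, A x & ~ U x.
  by apply: contrapT => H; apply: AU => x Ax; apply: contrapT => Ux; apply: H; exists x.
exists x => //; apply: (@uniformly_recurrent_minimal S (A `&` ~` U)) => //.
- by apply: closedI => //; exact: open_closedC.
- by move=> y [Ay nUy]; split; [exact: iA|move=> /iU].
move=> y [Ay nUy]; apply: contrapT => nx.
(* Adding the complement of the orbit closure of [y] would enlarge [U] strictly, by [x], and still
   miss [y], against maximality. *)
apply: (maxU (U `|` ~` closure (orbit y))).
  by split; [exact: subsetUl|move=> H; apply/nUx/H; right].
split.
- by apply: openU => //; apply: closed_openC; exact: closed_closure.
- move=> z [/iU|nz]; [by left|right=> /forward_invariant_closure_orbit].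
  exact: nz.
by move=> /(_ y Ay)[//|]; apply; exact: closure_orbit_refl.
Qed.

Lemma uniformly_recurrent_factor S1 S2 (f : S1 -> S2) x :
  continuous f -> (forall y, f (tds_map y) = tds_map (f y)) ->
  uniformly_recurrent x -> uniformly_recurrent (f x).
Proof.
move=> cf fT Hx e e0.
have fiter n y : f (iter n tds_map y) = iter n tds_map (f y).
  by elim: n => //= n <-.
have [d d0 Hd] := continuous_mdist x cf e0.
have [L HL] := Hx _ d0; exists L => n; have [i iL xi] := HL n.
by exists i => //; rewrite -!fiter; exact: Hd.
Qed.

Lemma uniformly_recurrent_iter S n (x : S) :
  uniformly_recurrent x -> uniformly_recurrent (iter n tds_map x).
Proof.
apply: uniformly_recurrent_factor; first exact: iter_continuous.
by move=> y; rewrite -iterSr.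
Qed.

(** * Recurrence in products, and transitivity in terms of distances *)

Lemma prod_mdist_lt (X Y : metricType R) (p q : X * Y) (e : R) :
  (mdist p q < e) = (mdist p.1 q.1 < e) && (mdist p.2 q.2 < e).
Proof. by rewrite -gt_max. Qed.

Lemma iter_prod_map S1 S2 n (p : prod_tds S1 S2) :
  iter n tds_map p = (iter n tds_map p.1, iter n tds_map p.2).
Proof. by elim: n => [|n /= ->] //; case: p. Qed.

(** The pair (p, q) itself may fail to be recurrent. A recurrent pair (a, b) exists in the product
    of the orbit closures, and its coordinates come near [p] and [q] at separate times [i] and
    [j]. *)
Lemma uniformly_recurrent_prod_dense S1 S2 (p : S1) (q : S2) (e : R) :
  uniformly_recurrent p -> uniformly_recurrent q -> 0 < e ->
  exists p' q', [/\ mdist p p' < e, mdist q q' < e &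
    @uniformly_recurrent (prod_tds S1 S2) (p', q')].
Proof.
move=> Hp Hq e0.
pose A : set (prod_tds S1 S2) := closure (orbit p) `*` closure (orbit q).
have [|||[a b] [/= Aa Ab] Hab] := @exists_uniformly_recurrent (prod_tds S1 S2) A.
- apply: closedI; apply: preimage_closed; try exact: closed_closure.
    by move=> z _; exact: cvg_fst.
  by move=> z _; exact: cvg_snd.
- by move=> [x y] [/= ? ?]; split; exact: forward_invariant_closure_orbit.
- by exists (p, q); split; exact: closure_orbit_refl.
have := uniformly_recurrent_closure_orbit Hp Aa.
move=> /closure_mdist/(_ _ e0)[_ [i _ <-] pi].
have := uniformly_recurrent_closure_orbit Hq Ab.
move=> /closure_mdist/(_ _ e0)[_ [j _ <-] qj].
(* T^i x T^j commutes with T x T even when [i] and [j] differ, so it preserves recurrence. *)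
exists (iter i tds_map a), (iter j tds_map b); split=> //.
pose f (z : prod_tds S1 S2) : prod_tds S1 S2 :=
  (iter i tds_map z.1, iter j tds_map z.2).
apply: (@uniformly_recurrent_factor _ _ f (a, b)) => //.
  move=> z; apply: cvg_pair => /=.
    by apply: continuous_comp; [exact: cvg_fst|exact: iter_continuous].
  by apply: continuous_comp; [exact: cvg_snd|exact: iter_continuous].
by move=> z; congr pair => /=; rewrite -iterSr.
Qed.

Lemma transitiveP S : transitive_tds S <->
  forall (x y : S) (e : R), 0 < e -> infinite_set
    [set n | exists2 z, mdist x z < e & mdist y (iter n tds_map z) < e].
Proof.
split=> [tS x y e e0|H U V oU oV [x Ux] [y Vy]].
  have := tS _ _ (@open_interior _ _) (@open_interior _ _)
    (ex_intro _ x (interior_mdist x e0)) (ex_intro _ y (interior_mdist y e0)).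
  apply: contra_not; apply: sub_finite_set => n [z [Vz Uz]].
  by exists z; [exact: (interior_subset Uz)|exact: (interior_subset Vz)].
have [d d0 dU] := open_mdist oU Ux.
have [e e0 eV] := open_mdist oV Vy.
have m0 : 0 < Num.min d e by rewrite lt_min d0.
apply: contra_not (H x y _ m0); apply: sub_finite_set => n [z].
rewrite !lt_min => /andP[xz _] /andP[_ yz].
by exists z; split; [exact: eV|exact: dU].
Qed.

End Recurrence.

(** * Singletons, unions and finite sets as points of K(X), with Hausdorff estimates *)

Section HyperspacePoints.
Context {R : realType} {X : compactMetricType R}.
Implicit Types C D : hyperspace X.

Lemma hset1_closed (x : X) : closed [set x].
Proof.
by apply: compact_closed; [exact: metric_hausdorff|exact: compact_set1].
Qed.

Definition hset1 (x : X) : hyperspace X :=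
  Hyperspace (@hset1_closed x) (ex_intro _ x erefl).

Lemma hsetU_nonempty C D : (C `|` D : set X) !=set0.
Proof. by have [c Cc] := hset_nonempty C; exists c; left. Qed.

Definition hsetU C D : hyperspace X :=
  Hyperspace (closedU (hset_closed (h := C)) (hset_closed (h := D)))
    (hsetU_nonempty C D).

(** Keeping the head apart makes the set non-empty; building it from singletons and unions allows
    induction on the list. *)
Fixpoint hset_seq (x : X) (s : seq X) : hyperspace X :=
  if s is y :: s' then hsetU (hset1 x) (hset_seq y s') else hset1 x.

Lemma hset_seqP x s y : hset (hset_seq x s) y <-> y \in x :: s.
Proof.
elim: s x => [|z s IHs] x /=; first by rewrite inE; split=> /eqP.
rewrite in_cons; split=> [[->|/IHs ->]|/orP[/eqP ->|zs]]; rewrite ?eqxx ?orbT//.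
  by left.
by right; apply/IHs.
Qed.

Lemma hmdist_lt C D (e e' : R) : 0 < e' -> e' < e ->
  (forall c, hset C c -> exists2 d, hset D d & mdist c d < e') ->
  (forall d, hset D d -> exists2 c, hset C c & mdist c d < e') -> mdist C D < e.
Proof.
move=> e'0 e'e CD DC; rewrite hyperspace_mdistE; apply/hausdorff_dist_lt.
exists e' => //; split=> // x; last first.
  by move=> /DC[c Cc cx]; apply/thickeningP; exists c.
by move=> /CD[d Dd xd]; apply/thickeningP; exists d; rewrite // metric_sym.
Qed.

Lemma hmdist_near C D (e : R) c : mdist C D < e -> hset C c ->
  exists2 d, hset D d & mdist c d < e.
Proof.
rewrite hyperspace_mdistE => /hausdorff_dist_lt[e' e'e [_ CD _]] /CD.
by move=> /thickeningP[d Dd dc]; exists d => //; rewrite metric_sym (lt_trans dc).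
Qed.

Lemma hmdist_hset1_sub x D (e : R) d : mdist (hset1 x) D < e -> hset D d ->
  mdist x d < e.
Proof.
by rewrite metric_sym => Dx /(hmdist_near Dx)[_ ->]; rewrite metric_sym.
Qed.

Lemma hmdist_hset1 (x y : X) (e : R) :
  mdist x y < e -> mdist (hset1 x) (hset1 y) < e.
Proof.
move=> xy; have e0 : 0 < e by exact: le_lt_trans (mdist_ge0 _ _) xy.
have [e' e'e xye'] : exists2 e', e' < e & mdist x y < e'.
  by exists ((mdist x y + e) / 2); lra.
apply: (@hmdist_lt _ _ _ e') => //; first exact: le_lt_trans (mdist_ge0 _ _) xye'.
  by move=> _ ->; exists y.
by move=> _ ->; exists x.
Qed.

Lemma hmdist_hsetU C C' D D' (e : R) :
  mdist C C' < e -> mdist D D' < e -> mdist (hsetU C D) (hsetU C' D') < e.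
Proof.
move=> CC' DD'; have e0 : 0 < e by exact: le_lt_trans (mdist_ge0 _ _) CC'.
have [e' e'e [Ce' De']] : exists2 e', e' < e & mdist C C' < e' /\ mdist D D' < e'.
  exists ((Num.max (mdist C C') (mdist D D') + e) / 2).
    have : Num.max (mdist C C') (mdist D D') < e by rewrite gt_max CC'.
    lra.
  have : mdist C C' <= Num.max (mdist C C') (mdist D D') by rewrite le_max lexx.
  have : mdist D D' <= Num.max (mdist C C') (mdist D D').
    by rewrite le_max lexx orbT.
  by split; lra.
apply: (@hmdist_lt _ _ _ e') => //; first exact: le_lt_trans (mdist_ge0 _ _) Ce'.
  move=> x [/(hmdist_near Ce')|/(hmdist_near De')] [y ? ?]; exists y => //.
    by left.
  by right.
rewrite metric_sym in Ce'; rewrite metric_sym in De'.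
move=> x [/(hmdist_near Ce')|/(hmdist_near De')] [y ? ?]; exists y;
  rewrite 1?metric_sym//; by [left|right].
Qed.

Lemma hset_seq_dense C (e : R) : 0 < e ->
  exists x s, mdist C (hset_seq x s) < e.
Proof.
move=> e0; have e20 : 0 < e / 2 by rewrite divr_gt0.
have [[|x s] tC Ct] := finite_net (hset_closed (h := C)) e20.
  by have [c /Ct[]] := hset_nonempty C.
exists x, s.
apply: (@hmdist_lt _ _ _ (e / 2)) => //; first lra.
  by move=> c /Ct[y ys yc]; exists y; [apply/hset_seqP|rewrite metric_sym].
by move=> d /hset_seqP ds; exists d; [exact: tC|rewrite mdistxx].
Qed.

End HyperspacePoints.

(** * Transitivity of K(X) and weak mixing of X *)

Section Hyperdynamics.
Context {R : realType} {S : tds R}.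
Implicit Types C D : hyper_tds S.

Lemma iter_hyper_mapE n C x :
  hset (iter n tds_map C) x <-> exists2 c, hset C c & iter n tds_map c = x.
Proof.
elim: n x => [|n IHn] x /=; first by split=> [|[_ ? <-]//]; exists x.
split=> [[y /IHn[c Cc <-] <-]|[c Cc <-]]; first by exists c.
by exists (iter n tds_map c) => //; apply/IHn; exists c.
Qed.

(** If [C] is near {x}, all its points are near [x]; if T^n C is near {y1, y2}, it has a point near
    each of [y1] and [y2]. *)
Lemma hyper_transitive_pair : transitive_tds (hyper_tds S) ->
  forall (x y1 y2 : S) (e : R), 0 < e -> infinite_set
    [set n | exists2 z1, mdist x z1 < e & exists2 z2, mdist x z2 < e &
      mdist y1 (iter n tds_map z1) < e /\ mdist y2 (iter n tds_map z2) < e].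
Proof.
move=> /transitiveP tK x y1 y2 e e0.
have := tK (hset1 x) (hsetU (hset1 y1) (hset1 y2)) e e0.
apply: contra_not; apply: sub_finite_set => n [C xC yC].
have [|_ /iter_hyper_mapE[z1 Cz1 <-] yz1] := hmdist_near yC (c := y1).
  by left.
have [|_ /iter_hyper_mapE[z2 Cz2 <-] yz2] := hmdist_near yC (c := y2).
  by right.
exists z1; first exact: hmdist_hset1_sub xC Cz1.
by exists z2; first exact: hmdist_hset1_sub xC Cz2.
Qed.

Lemma hyper_transitive_transitive :
  transitive_tds (hyper_tds S) -> transitive_tds S.
Proof.
move=> /hyper_transitive_pair tK; apply/transitiveP => x y e e0.
apply: contra_not (tK x y y e e0); apply: sub_finite_set.
by move=> n [z xz [_ _ [yz _]]]; exists z.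
Qed.

Lemma hyper_transitive_weakly_mixing :
  transitive_tds (hyper_tds S) -> weakly_mixing S.
Proof.
move=> tK; have /transitiveP tS := hyper_transitive_transitive tK.
apply/transitiveP => -[u1 u2] [v1 v2] e e0.
(* With m in N(U1, U2), any n in N(U, V1) and N(U, T^-m V2), where
   U = U1 `&` T^-m U2, is in N(U1, V1) and N(U2, V2). *)
have [m [z u1z u2z]] : exists m, exists2 z, mdist u1 z < e &
    mdist u2 (iter m tds_map z) < e.
  exact: infinite_setN0 (tS u1 u2 e e0).
(* The point [w] represents T^-m V2, non-empty by surjectivity; below, the [d1]-ball around [z]
   plays the role of U and the [d2]-ball around [w] that of T^-m V2. *)
have [w Tw] := iter_surjective m v2.
have [d1 d10 Hd1] : exists2 d : R, 0 < d & forall y, mdist z y < d ->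
    mdist u1 y < e /\ mdist u2 (iter m tds_map y) < e.
  have e'0 : 0 < e - mdist u2 (iter m tds_map z) by rewrite subr_gt0.
  have [d d0 H] := continuous_mdist z (@iter_continuous R S m) e'0.
  exists (Num.min d (e - mdist u1 z)); first by rewrite lt_min d0 subr_gt0.
  move=> y; rewrite lt_min => /andP[/H zy zy']; split.
    by apply: le_lt_trans (metric_triangle u1 z y) _; lra.
  by apply: le_lt_trans (metric_triangle u2 (iter m tds_map z) _) _; lra.
have [d2 d20 Hd2] := continuous_mdist w (@iter_continuous R S m) e0.
have r0 : 0 < Num.min e (Num.min d1 d2) by rewrite !lt_min e0 d10.
have /hyper_transitive_pair/(_ z v1 w _ r0) := tK; apply: contra_not.
apply: sub_finite_set => n [c1 + [c2 +]]; rewrite !lt_min.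
move=> /and3P[_ /Hd1[u1c1 _] _] /and3P[_ /Hd1[_ u2c2] _].
move=> [/and3P[v1c1 _ _] /and3P[_ _ /Hd2]]; rewrite Tw => v2c2.
exists (c1, iter m tds_map c2); first by rewrite prod_mdist_lt u1c1.
by rewrite iter_prod_map prod_mdist_lt v1c1 /= -iterD addnC iterD.
Qed.

(* Furstenberg's intersection lemma: N(U, V) is contained in each N(Ui, Vi). *)
Lemma weakly_mixing_common_hitting (s : seq (S * S)) (e : R) (x0 : S) :
  weakly_mixing S -> 0 < e ->
  exists U V : set S, [/\ open U, open V, U !=set0, V !=set0 &
    forall n, iter n tds_map @^-1` V `&` U !=set0 ->
    forall p, p \in s -> exists2 z, mdist p.1 z < e &
      mdist p.2 (iter n tds_map z) < e].
Proof.
move=> wm e0; elim: s => [|[x y] s [U [V [oU oV [u Uu] [v Vv] H]]]].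
  by exists setT, setT; split=> //; [exact: openT|exact: openT|exists x0|exists x0].
have [d d0 dU] := open_mdist oU Uu.
have [d' d'0 d'V] := open_mdist oV Vv.
have r0 : 0 < Num.min e (Num.min d d') by rewrite !lt_min e0 d0.
(* A single time [m] takes a point near [x] into [U] and a point near [y] into [V]. *)
have tp := iffLR (transitiveP _) wm (x, y) (u, v) _ r0.
have [m [[a b]]] : exists m, exists2 z : prod_tds S S,
    mdist (x, y) z < Num.min e (Num.min d d') &
    mdist (u, v) (iter m tds_map z) < Num.min e (Num.min d d').
  exact: infinite_setN0 tp.
rewrite iter_prod_map !prod_mdist_lt !lt_min /=.
move=> /andP[/and3P[xa _ _] /and3P[yb _ _]] /andP[/and3P[_ + _] /and3P[_ _]].
move=> /dU Ua /d'V Vb.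
have oT (W : set S) : open W -> open (iter m tds_map @^-1` W).
  by move=> oW; apply: open_comp oW => z _; exact: iter_continuous.
(* If [c] and T^n c lie in the new sets, then T^m c is in [U] and T^n (T^m c) in [V], so hitting
   times of the new pair are hitting times of the old one. *)
exists ([set z | mdist x z < e]° `&` iter m tds_map @^-1` U),
  ([set z | mdist y z < e]° `&` iter m tds_map @^-1` V).
have inb (z z' : S) : mdist z z' < e -> [set t | mdist z t < e]° z'.
  move=> zz'; have e'0 : 0 < e - mdist z z' by rewrite subr_gt0.
  apply: filterS (near_mdist z' e'0) => t z't /=.
  by apply: le_lt_trans (metric_triangle z z' t) _; lra.
split.
- by apply: openI; [exact: open_interior|exact: oT].
- by apply: openI; [exact: open_interior|exact: oT].
- by exists a; split=> //; exact: inb.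
- by exists b; split=> //; exact: inb.
move=> n [c [[/interior_subset yc Vc] [/interior_subset xc Uc]]] p.
rewrite in_cons => /orP[/eqP ->|]; first by exists c.
apply: H; exists (iter m tds_map c); split=> //.
by rewrite /= -iterD addnC iterD.
Qed.

(** Each pair (a, b) of points of the two approximating finite sets gets a point near [a] whose n-th
    image is near [b]. The set of these points is near the first finite set, its n-th image near the
    second. *)
Lemma weakly_mixing_hyper_transitive :
  weakly_mixing S -> transitive_tds S -> transitive_tds (hyper_tds S).
Proof.
move=> wm tS; apply/transitiveP => C D e e0.
have e20 : 0 < e / 2 by rewrite divr_gt0.
have e40 : 0 < e / 2 / 2 by rewrite divr_gt0.
have [c [s Cs]] := hset_seq_dense C e20.
have [d [t Dt]] := hset_seq_dense D e20.
pose l := [seq (a, b) | a <- c :: s, b <- d :: t].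
have [U [V [oU oV U0 V0 H]]] := weakly_mixing_common_hitting l c wm e40.
apply: contra_not (tS _ _ oU oV U0 V0); apply: sub_finite_set => n /H {}H.
(* Outside [l], the default value is [c]. *)
have /choice[f Hf] : forall p : S * S, exists z, p \in l ->
    mdist p.1 z < e / 2 / 2 /\ mdist p.2 (iter n tds_map z) < e / 2 / 2.
  move=> p; have [pl|npl] := boolP (p \in l); last by exists c.
  by have [z] := H p pl; exists z.
have lP a b : a \in c :: s -> b \in d :: t -> (a, b) \in l.
  by move=> *; exact: allpairs_f.
have [q [r qr]] : exists q r, q :: r = map f l.
  by rewrite /l /=; eexists; eexists.
pose E : hyper_tds S := hset_seq q r.
have EP z : hset E z <-> exists2 p, p \in l & z = f p.
  split=> [/hset_seqP|[p pl ->]]; first by rewrite qr => /mapP.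
  by apply/hset_seqP; rewrite qr map_f.
exists E.
  apply: le_lt_trans (metric_triangle C (hset_seq c s) E) _.
  suff : mdist (hset_seq c s) E < e / 2 by lra.
  apply: (@hmdist_lt _ _ _ _ _ (e / 2 / 2)) => //; first by lra.
    move=> a /hset_seqP al; have := lP a d al (mem_head _ _) => adl.
    by exists (f (a, d)); [apply/EP; exists (a, d)|have [] := Hf _ adl].
  move=> _ /EP[p pl ->]; have [? _] := Hf _ pl; exists p.1 => //.
  by apply/hset_seqP; move: pl => /allpairsP[[a b] [? ? ->]].
apply: le_lt_trans (metric_triangle D (hset_seq d t) _) _.
suff : mdist (hset_seq d t : hyper_tds S) (iter n tds_map E) < e / 2 by lra.
apply: (@hmdist_lt _ _ _ _ _ (e / 2 / 2)) => //; first by lra.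
  move=> b /hset_seqP bl; have := lP c b (mem_head _ _) bl => cbl.
  exists (iter n tds_map (f (c, b))); last by have [] := Hf _ cbl.
  by apply/iter_hyper_mapE; exists (f (c, b)) => //; apply/EP; exists (c, b).
move=> _ /iter_hyper_mapE[_ /EP[p pl ->] <-]; have [_ ?] := Hf _ pl; exists p.2 => //.
by apply/hset_seqP; move: pl => /allpairsP[[a b] [? ? ->]].
Qed.

(** * Density of minimal points in K(X) and in X *)

Lemma uniformly_recurrent_hset1 (x : S) :
  uniformly_recurrent x -> @uniformly_recurrent R (hyper_tds S) (hset1 x).
Proof.
apply: (@uniformly_recurrent_factor R S (hyper_tds S) (fun y => hset1 y)).
  move=> y U /nbhs_mdist[e e0 yU]; apply/nbhs_mdist; exists e => // z yz.
  exact/yU/hmdist_hset1.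
by move=> y; apply: hyperspace_eq; rewrite /= image_set1.
Qed.

Lemma uniformly_recurrent_hsetU C D :
  @uniformly_recurrent R (prod_tds (hyper_tds S) (hyper_tds S)) (C, D) ->
  @uniformly_recurrent R (hyper_tds S) (hsetU C D).
Proof.
pose f (p : prod_tds (hyper_tds S) (hyper_tds S)) : hyper_tds S := hsetU p.1 p.2.
apply: (@uniformly_recurrent_factor R _ _ f).
  move=> p U /nbhs_mdist[e e0 pU]; apply/nbhs_mdist; exists e => // q.
  by rewrite prod_mdist_lt => /andP[? ?]; apply: pU; exact: hmdist_hsetU.
by move=> p; apply: hyperspace_eq; rewrite /= image_setU.
Qed.

Lemma hyper_minimal_point_dense :
  dense [set x : S | minimal_point x] ->
  dense [set C : hyper_tds S | minimal_point C].
Proof.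
move=> /dense_mdist dS.
have {}dS (x : S) (e : R) : 0 < e -> exists2 y, uniformly_recurrent y & mdist x y < e.
  by move=> /(dS x)[y /= /minimal_pointP]; exists y.
pose G C := forall e : R, 0 < e ->
  exists2 D : hyper_tds S, uniformly_recurrent D & mdist C D < e.
have G1 x : G (hset1 x).
  move=> e /(dS x)[y Hy xy]; exists (hset1 y); last exact: hmdist_hset1.
  exact: uniformly_recurrent_hset1.
have GU C D : G C -> G D -> G (hsetU C D).
  move=> GC GD e e0; have e20 : 0 < e / 2 by rewrite divr_gt0.
  have [C' HC CC'] := GC _ e20; have [D' HD DD'] := GD _ e20.
  (* Recurrence of [C'] and [D'] separately does not give that of the pair, which is therefore moved
     slightly. *)
  have [C2 [D2 [CC2 DD2 H]]] := uniformly_recurrent_prod_dense HC HD e20.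
  exists (hsetU C2 D2); first exact: uniformly_recurrent_hsetU.
  apply: hmdist_hsetU.
    by apply: le_lt_trans (metric_triangle C C' C2) _; lra.
  by apply: le_lt_trans (metric_triangle D D' D2) _; lra.
have Gs x s : G (hset_seq x s).
  by elim: s x => [|y s IHs] x; [exact: G1|apply: GU].
apply/dense_mdist => C e e0; have e20 : 0 < e / 2 by rewrite divr_gt0.
have [x [s Cs]] := hset_seq_dense C e20.
have [D HD sD] := Gs x s _ e20; exists D; first exact/minimal_pointP.
by apply: le_lt_trans (metric_triangle C (hset_seq x s) D) _; lra.
Qed.

(* If C is minimal and close to {x}, then by syndeticity the orbit closure of
   any c in C, hence any minimal set in it, visits a neighbourhood of x. *)
Lemma minimal_point_dense_hyper :
  dense [set C : hyper_tds S | minimal_point C] ->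
  dense [set x : S | minimal_point x].
Proof.
move=> /dense_mdist dK; apply/dense_mdist => x e e0.
have e30 : 0 < e / 3 by rewrite divr_gt0.
have [C /minimal_pointP HC xC] := dK (hset1 x) _ e30.
have [L HL] := HC _ e30.
have [c Cc] := hset_nonempty C.
have [|||y cy Hy] := @exists_uniformly_recurrent R S (closure (orbit c)).
- exact: closed_closure.
- exact: forward_invariant_closure_orbit.
- by exists c; exact: closure_orbit_refl.
(* Within [L] steps, [y] shadows a point T^n c close to it, and C returns near itself. *)
have [d d0 Hd] := iter_continuous_upto L y e30.
have /closure_mdist/(_ _ d0)[_ [n _ <-] yn] := cy.
have [i iL Ci] := HL n.
exists (iter i tds_map y); first exact/minimal_pointP/uniformly_recurrent_iter.
rewrite metric_sym -iterD in Ci.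
have [|c' Cc' cc'] := hmdist_near Ci (c := iter (i + n) tds_map c).
  by apply/iter_hyper_mapE; exists c.
have xc' := hmdist_hset1_sub xC Cc'.
have := Hd i _ iL yn; rewrite -iterD metric_sym => ic.
(* Three thirds of [e]: from [x] to [c'], on to T^(i+n) c, and on to T^i y. *)
apply: le_lt_trans (metric_triangle x c' _) _.
have := metric_triangle c' (iter (i + n) tds_map c) (iter i tds_map y).
by rewrite (metric_sym c' (iter (i + n) tds_map c)); lra.
Qed.

End Hyperdynamics.

Theorem theorem3p5 (R : realType) (X : tds R) :
  weakly_mixing X /\ M_system X <-> M_system (hyper_tds X).
Proof.
split=> [[wm [tX dX]]|[tK dK]]; split.
- exact: weakly_mixing_hyper_transitive.
- exact: hyper_minimal_point_dense.
- exact: hyper_transitive_weakly_mixing.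
split; first exact: hyper_transitive_transitive.
exact: minimal_point_dense_hyper.
Qed.
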